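(* Let $\theta\in\mathtt{S}=\{0,1,\nu,2\nu,3\nu,2+\nu,2+3\nu,3+2\nu\}$, $n\ge1$, and let $\mathtt{C}_{\theta}=\langle g_{\theta_1}(z),g_{\theta_2}(z),g_{\theta_3}(z),g_{\theta_4}(z)\rangle$ be a cyclic code of arbitrary length $n$ over $\mathtt{R}_{\theta}=Z_4+\nu Z_4$, $\nu^2=\theta$, where $$g_{\theta_1}=g_{11}+2g_{12}+k_\theta g_{13}+2k_\theta g_{14},\quad g_{\theta_2}=2g_{22}+k_\theta g_{23}+2k_\theta g_{24},\quad g_{\theta_3}=k_\theta g_{33}+2k_\theta g_{34},\quad g_{\theta_4}=2k_\theta g_{44},$$ such that the polynomials $g_{ij}(z)\in Z_2[z]/\langle z^n-1\rangle$ satisfy (1) $g_{22}\mid g_{11}\mid z^n-1$; (2) either $g_{12}=0$, or $g_{22}\mid g_{12}\frac{z^n-1}{g_{11}}$ with $\deg g_{22}>\deg g_{12}$; (3) $g_{44}\mid g_{33}\mid z^n-1$; (4) either $g_{34}=0$, or $g_{44}\mid g_{34}\frac{z^n-1}{g_{33}}$ with $\deg g_{44}>\deg g_{34}$; with either $g_{ij}(z)=0$ or $\deg g_{ij}(z)<\deg g_{jj}(z)$ for $1\le i\le3$, $i<j\le4$, and $g_{ii}(z)$ the unique minimal degree polynomial generator of $\mathtt{C}_{\theta_i}$, $1\le i\le4$. Then the polynomials $g_{\theta_1}(z),g_{\theta_2}(z),g_{\theta_3}(z),g_{\theta_4}(z)$ are uniquely determined: if $h_{\theta_1},h_{\theta_2},h_{\theta_3},h_{\theta_4}$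 is another set of generators of $\mathtt{C}_\theta$ of the same form, with binary polynomials $h_{ij}$ satisfying all the same conditions, then $g_{\theta_i}=h_{\theta_i}$ for $1\le i\le4$.
   Context: For $\theta\in\mathtt{S}$, $\mathtt{R}_\theta=Z_4+\nu Z_4=\{a+b\nu: a,b\in Z_4\}$ is the commutative ring $Z_4[\nu]/\langle \nu^2-\theta\rangle$, where $Z_m$ denotes the integers modulo $m$. Define $k_\theta=\nu$ for $\theta\in\{0,\nu,2\nu,3\nu\}$, $k_\theta=1+\nu$ for $\theta\in\{1,3+2\nu\}$, and $k_\theta=2+\nu$ for $\theta\in\{2+\nu,2+3\nu\}$. A cyclic code of length $n$ over $\mathtt{R}_\theta$ is an $\mathtt{R}_\theta$-submodule of $\mathtt{R}_\theta^n$ closed under the cyclic shift $(s_0,\dots,s_{n-1})\mapsto(s_{n-1},s_0,\dots,s_{n-2})$; identifying $(s_0,\dots,s_{n-1})$ with $s_0+s_1z+\cdots+s_{n-1}z^{n-1}$, it is an ideal of $\mathtt{R}_\theta[z]/\langle z^n-1\rangle$. Angle brackets around polynomials denote the ideal generated in this ring. Binary polynomials are regarded as polynomials over $Z_4\subseteq\mathtt{R}_\theta$ by reading their coefficients as $0,1$; divisibility among binary polynomials is in $Z_2[z]$. Associated to $\mathtt{C}_\theta$ are the following ideals of $Z_2[z]/\langle z^n-1\rangle$: $\mathtt{C}_{\theta_1}=\mathtt{C}_\theta \bmod (2,k_\theta)$; $\mathtt{C}_{\theta_2}=\{a(z): 2a(z)\in \mathtt{C}_\theta \bmod k_\theta\}$;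 $\mathtt{C}_{\theta_3}=\{a(z): k_\theta a(z)\in \mathtt{C}_\theta \bmod 2k_\theta\}$; $\mathtt{C}_{\theta_4}=\{a(z): 2k_\theta a(z)\in\mathtt{C}_\theta\}$ (with $a(z)$ binary). Equivalently, with $\mathrm{Res}(\mathtt{C}_\theta)=\{a\in Z_4[z]/\langle z^n-1\rangle: a+k_\theta b\in\mathtt{C}_\theta \text{ for some } b\in Z_4[z]/\langle z^n-1\rangle\}$ and $\mathrm{Tor}(\mathtt{C}_\theta)=\{a\in Z_4[z]/\langle z^n-1\rangle: k_\theta a\in\mathtt{C}_\theta\}$, $\mathtt{C}_{\theta_1},\mathtt{C}_{\theta_2}$ are the residue (reduction mod $2$) and torsion ($\{a: 2a\in\cdot\}$) codes of $\mathrm{Res}(\mathtt{C}_\theta)$, and $\mathtt{C}_{\theta_3},\mathtt{C}_{\theta_4}$ are those of $\mathrm{Tor}(\mathtt{C}_\theta)$. The minimal degree polynomial generator of $\mathtt{C}_{\theta_i}$ is the divisor of $z^n-1$ in $Z_2[z]$ generating it ($z^n-1$ itself, of degree $n$, if the ideal is zero). *)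

(* Defs.v *)
From HB Require Import structures.
From mathcomp Require Import all_boot all_order all_algebra.
Set Implicit Arguments.
Unset Strict Implicit.
Unset Printing Implicit Defensive.
Import GRing.Theory.
Local Open Scope ring_scope.

(* A pair (a, b) stands for theta = a + b nu. *)
Definition theta_set : seq ('Z_4 * 'Z_4) :=
  [:: (0, 0); (1, 0); (0, 1); (0, 2); (0, 3); (2, 1); (2, 3); (3, 2)].

Definition theta_poly (theta : 'Z_4 * 'Z_4) : {poly 'Z_4} :=
  theta.1%:P + theta.2 *: 'X.

Definition ring_R (theta : 'Z_4 * 'Z_4) : Type :=
  {poly %/ 'X^2 - theta_poly theta}.

HB.instance Definition _ (theta : 'Z_4 * 'Z_4) :=
  GRing.ComNzRing.on (ring_R theta).

Definition nu (theta : 'Z_4 * 'Z_4) : ring_R theta :=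
  in_qpoly ('X^2 - theta_poly theta) 'X.

Definition k_elt (theta : 'Z_4 * 'Z_4) : ring_R theta :=
  if theta \in [:: (1, 0); (3, 2)] then 1 + nu theta
  else if theta \in [:: (2, 1); (2, 3)] then 2 + nu theta
  else nu theta.

Definition cyclic_ring (A : comNzRingType) (n : nat) : Type :=
  {poly %/ ('X^n - 1 : {poly A})}.

HB.instance Definition _ (A : comNzRingType) (n : nat) :=
  GRing.ComNzRing.on (cyclic_ring A n).

Definition cls (A : comNzRingType) (n : nat) (p : {poly A}) : cyclic_ring A n :=
  in_qpoly ('X^n - 1) p.

Definition ideal_span (A : comNzRingType) (s : seq A) (x : A) : Prop :=
  exists c : seq A, x = \sum_(i < size s) c`_i * s`_i.

Definition cyclic_shift (A : Type) (n : nat) (s : 'rV[A]_n) : 'rV[A]_n :=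
  \row_i s 0 (ord_pred i).

Definition cyclic_code (A : comNzRingType) (n : nat) (C : {pred 'rV[A]_n}) : Prop :=
  submod_closed C /\ {in C, forall s, cyclic_shift s \in C}.

Definition code_ideal (A : comNzRingType) (n : nat) (C : {pred 'rV[A]_n})
  (x : cyclic_ring A n) : Prop :=
  exists2 s, s \in C & x = cls n (rVpoly s).

Section Components.
Variables (theta : 'Z_4 * 'Z_4) (n : nat).
Local Notation Q := (cyclic_ring (ring_R theta) n).
Local Notation B := (cyclic_ring 'F_2 n).

Definition kQ : Q := cls n (k_elt theta)%:P.

(* The lift is applied to the representative of degree < n, so that the class
   of z^n - 1 lifts to 0 (coefficientwise, z^n + 1 would give 2). *)
Definition lift01 (a : B) : Q :=
  cls n (\poly_(i < n) (nat_of_ord (a : {poly 'F_2})`_i)%:R).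

Definition in_mod (I : Q -> Prop) (J : seq Q) (x : Q) : Prop :=
  exists2 c, I c & ideal_span J (x - c).

Definition component1 (C : {pred 'rV[ring_R theta]_n}) (a : B) : Prop :=
  in_mod (code_ideal C) [:: 2; kQ] (lift01 a).

Definition component2 (C : {pred 'rV[ring_R theta]_n}) (a : B) : Prop :=
  in_mod (code_ideal C) [:: kQ] (2 * lift01 a).

Definition component3 (C : {pred 'rV[ring_R theta]_n}) (a : B) : Prop :=
  in_mod (code_ideal C) [:: 2 * kQ] (kQ * lift01 a).

Definition component4 (C : {pred 'rV[ring_R theta]_n}) (a : B) : Prop :=
  code_ideal C (2 * kQ * lift01 a).

Definition min_generator (I : B -> Prop) (p : {poly 'F_2}) : Prop :=
  p %| 'X^n - 1 /\ (forall a, I a <-> ideal_span [:: cls n p] a).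

(* A family of binary polynomials is indexed by pairs of natural numbers, as
   in g_{ij}; only the entries with 1 <= i <= j <= 4 are ever used. *)
Definition binary_family : Type := nat -> nat -> {poly 'F_2}.

Section Generators.
Variable g : binary_family.
Local Notation "''g_' i j" := (lift01 (cls n (g i j)))
  (at level 8, i at level 2, j at level 2, format "''g_' i j").

Definition gen1 : Q := 'g_1 1 + 2 * 'g_1 2 + kQ * 'g_1 3 + 2 * kQ * 'g_1 4.
Definition gen2 : Q := 2 * 'g_2 2 + kQ * 'g_2 3 + 2 * kQ * 'g_2 4.
Definition gen3 : Q := kQ * 'g_3 3 + 2 * kQ * 'g_3 4.
Definition gen4 : Q := 2 * kQ * 'g_4 4.

End Generators.

(* For nonzero binary polynomials, comparing sizes is comparing degrees. *)
Record standard_generators (C : {pred 'rV[ring_R theta]_n}) (g : binary_family) :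
  Prop := StandardGenerators {
  sg_span : forall x,
    code_ideal C x <-> ideal_span [:: gen1 g; gen2 g; gen3 g; gen4 g] x;
  sg_div1 : g 2 2 %| g 1 1 /\ g 1 1 %| 'X^n - 1;
  sg_off1 : g 1 2 = 0 \/
    g 2 2 %| g 1 2 * (('X^n - 1) %/ g 1 1) /\ (size (g 1 2) < size (g 2 2))%N;
  sg_div3 : g 4 4 %| g 3 3 /\ g 3 3 %| 'X^n - 1;
  sg_off3 : g 3 4 = 0 \/
    g 4 4 %| g 3 4 * (('X^n - 1) %/ g 3 3) /\ (size (g 3 4) < size (g 4 4))%N;
  sg_deg : forall i j, (1 <= i <= 3)%N -> (i < j <= 4)%N ->
    g i j = 0 \/ (size (g i j) < size (g j j))%N;
  sg_min1 : min_generator (component1 C) (g 1 1);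
  sg_min2 : min_generator (component2 C) (g 2 2);
  sg_min3 : min_generator (component3 C) (g 3 3);
  sg_min4 : min_generator (component4 C) (g 4 4)
}.

End Components.

Arguments gen1 theta n g : clear implicits.
Arguments gen2 theta n g : clear implicits.
Arguments gen3 theta n g : clear implicits.
Arguments gen4 theta n g : clear implicits.

(* Main.v *)
Require Import Defs.
From mathcomp Require Import all_boot all_order all_algebra.
From mathcomp Require Import ring.
Set Implicit Arguments.
Unset Strict Implicit.
Import GRing.Theory.
Local Open Scope ring_scope.

(** The diagonal polynomials agree because they are monic generators of the
    same ideal of Z_2[z]/(z^n - 1). In each row, at the first off-diagonal place
    j where the two families differ, subtracting the two generators shows that
    the difference of the binary polynomials lies in the j-th component ideal;
    its degree is below that of the generator of this ideal, so it vanishes. *)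

Lemma ideal_span1P (A : comNzRingType) (t x : A) :
  ideal_span [:: t] x <-> exists c, x = c * t.
Proof.
split=> [[c ->]|[c ->]]; first by exists c`_0; rewrite big_ord1.
by exists [:: c]; rewrite big_ord1.
Qed.

Lemma ideal_span_sub (A : comNzRingType) (s : seq A) (x y : A) :
  ideal_span s x -> ideal_span s y -> ideal_span s (x - y).
Proof.
move=> [c ->] [d ->]; exists (mkseq (fun i => c`_i - d`_i) (size s)).
rewrite -sumrB; apply: eq_bigr => i _.
by rewrite nth_mkseq // mulrBl.
Qed.

Lemma ideal_span_mem (A : comNzRingType) (s : seq A) (i : nat) :
  (i < size s)%N -> ideal_span s s`_i.
Proof.
move=> ltis; exists (mkseq (fun j => (j == i)%:R) (size s)).
rewrite (bigD1 (Ordinal ltis)) //= nth_mkseq // eqxx mul1r big1 ?addr0 //.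
move=> j; rewrite -val_eqE /= => /negPf neji.
by rewrite nth_mkseq // neji mul0r.
Qed.

Section BinaryIdeals.
Variables (n : nat) (n_gt0 : (0 < n)%N).
Implicit Types p q a b : {poly 'F_2}.

Let X_neq0 : 'X^n - 1 != 0 :> {poly 'F_2}.
Proof. by rewrite monic_neq0 ?monicXnsubC. Qed.

(** The quotient type reduces by [mk_monic], which falls back to ['X] unless its argument is monic
    of positive degree; for n > 0 no fallback occurs. *)
Lemma mk_monic_Xn_sub_1 : mk_monic ('X^n - 1 : {poly 'F_2}) = 'X^n - 1.
Proof. by rewrite /mk_monic size_XnsubC // ltnS n_gt0 monicXnsubC. Qed.

(** A divisor q of z^n - 1 still detects divisibility after reduction: p differs from a multiple of
    q by a multiple of z^n - 1. *)
Lemma dvdp_ideal_span_cls p q :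
  q %| 'X^n - 1 -> ideal_span [:: cls n q] (cls n p) -> q %| p.
Proof.
move=> dvd_q /ideal_span1P[c def_p].
have mon := monicXnsubC (1 : 'F_2) n_gt0.
have : 'X^n - 1 %| p - (c : {poly 'F_2}) * q.
  rewrite Pdiv.Field.dvdpE; apply/Pdiv.Ring.rmodp_eq0P.
  move/(congr1 val): def_p => /=; move: (polyn c) => {}c.
  rewrite mk_monic_Xn_sub_1.
  by rewrite Pdiv.RingMonic.rmodp_mulmr // Pdiv.RingMonic.rmodpB // => ->;
     rewrite subrr.
by move/(dvdp_trans dvd_q); rewrite dvdp_subl // dvdp_mull.
Qed.

Lemma monic_F2 p : p != 0 -> p \is monic.
Proof.
by rewrite -lead_coef_eq0 monicE; case: (lead_coef p) => -[|[|//]].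
Qed.

(** The two polynomials divide each other, and associates over F_2 coincide since every nonzero
    polynomial is monic. *)
Lemma min_generator_uniq (I : cyclic_ring 'F_2 n -> Prop) p q :
  min_generator I p -> min_generator I q -> p = q.
Proof.
move=> [dvd_p Ip] [dvd_q Iq].
have mem r : ideal_span [:: cls n r] (cls n r).
  by apply/ideal_span1P; exists 1; rewrite mul1r.
apply/eqP; rewrite -eqp_monic; last 2 first.
- by apply/monic_F2/(dvdpN0 dvd_p).
- by apply/monic_F2/(dvdpN0 dvd_q).
by apply/andP; split; apply: dvdp_ideal_span_cls => //;
   [apply/Ip/Iq | apply/Iq/Ip].
Qed.

Lemma min_generator_reduced_eq (I : cyclic_ring 'F_2 n -> Prop) p a b :
  min_generator I p -> I (cls n a - cls n b) ->
  a = 0 \/ (size a < size p)%N -> b = 0 \/ (size b < size p)%N -> a = b.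
Proof.
move=> [dvd_p Ip] Iab sa sb.
(* As p is nonzero, the zero polynomial also meets the strict size bound, so both disjunctions
   collapse. *)
have p_gt0 : (0 < size p)%N by rewrite size_poly_gt0 (dvdpN0 dvd_p).
have {}sa : (size a < size p)%N by case: sa => // ->; rewrite size_poly0.
have {}sb : (size b < size p)%N by case: sb => // ->; rewrite size_poly0.
have : p %| a - b.
  apply: dvdp_ideal_span_cls => //; apply/Ip.
  by rewrite /cls raddfB.
have [/eqP|ab_neq0] := eqVneq (a - b) 0; first by rewrite subr_eq0 => /eqP.
move/(dvdp_leq ab_neq0); rewrite leqNgt => /negP[].
by rewrite (leq_ltn_trans (size_polyD _ _)) // size_polyN gtn_max sa.
Qed.

End BinaryIdeals.

Section Uniqueness.
Variables (theta : 'Z_4 * 'Z_4) (n : nat).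
Local Notation Q := (cyclic_ring (ring_R theta) n).
Local Notation k := (kQ theta n).
Local Notation lift := (@lift01 theta n).

Lemma cyclic_ring_char4 : 4 = 0 :> Q.
Proof.
have R4 : 4 = 0 :> ring_R theta.
  rewrite -(rmorph_nat (in_qpoly ('X^2 - theta_poly theta)) 4).
  rewrite -[4%:R]polyC_natr.
  have -> : 4%:R = 0 :> 'Z_4 by apply/val_inj.
  by rewrite polyC0 rmorph0.
rewrite -(rmorph_nat (in_qpoly ('X^n - 1 : {poly ring_R theta})) 4).
by rewrite -[4%:R]polyC_natr R4 polyC0 rmorph0.
Qed.

(** The last summand is the borrow of the subtraction of binary digits. *)
Lemma natr_F2_sub (A : comNzRingType) (x y : 'F_2) :
  (nat_of_ord (x - y))%:R
    = (nat_of_ord x)%:R - (nat_of_ord y)%:R + 2 * ((x == 0) && (y != 0))%:R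
  :> A.
Proof.
(* Stated additively in the natural numbers; the only borrow is 0 - 1 = 1 in F_2, where 1 + 1 = 0 +
   2. *)
have carry : ((x - y)%R + y = x + 2 * ((x == 0) && (y != 0))%R)%N.
  by case: x y => [[|[|//]] ?] [[|[|//]] ?].
apply: (addIr (nat_of_ord y)%:R); rewrite -natrD carry natrD natrM.
ring.
Qed.

(** The lift is not additive, but the borrows, collected coefficientwise into c, make the error a
    multiple of 2. *)
Lemma lift01B (x y : cyclic_ring 'F_2 n) :
  exists c, lift (x - y) = lift x - lift y + 2 * c.
Proof.
pose c i := ((x : {poly 'F_2})`_i == 0) && ((y : {poly 'F_2})`_i != 0).
exists (cls n (\poly_(i < n) (c i)%:R)).
rewrite /lift01 /cls -(rmorph_nat (in_qpoly _) 2) -rmorphM -rmorphB -rmorphD.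
congr in_qpoly; apply/polyP => i.
rewrite coefD coefB mulr_natl coefMn !coef_poly.
case: ltnP => _; last by rewrite mul0rn subrr addr0.
by rewrite /= coefB natr_F2_sub mulr_natl.
Qed.

(** Multiplied by 2, the borrow term becomes 4c = 0; the tail k u disappears modulo k. *)
Lemma component2_diff (C : {pred 'rV[ring_R theta]_n}) (x y : cyclic_ring 'F_2 n)
    (u : Q) :
  code_ideal C (2 * (lift x - lift y) + k * u) -> component2 C (x - y).
Proof.
move=> Cxy; exists (2 * (lift x - lift y) + k * u) => //.
have [c ->] := lift01B x y; apply/ideal_span1P; exists (- u).
transitivity (4 * c - u * k); first by ring.
by rewrite cyclic_ring_char4; ring.
Qed.

(** The borrow contributes 2 k c, which is absorbed modulo 2 k together with the tail. *)
Lemma component3_diff (C : {pred 'rV[ring_R theta]_n}) (x y : cyclic_ring 'F_2 n)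
    (u : Q) :
  code_ideal C (k * (lift x - lift y) + 2 * k * u) -> component3 C (x - y).
Proof.
move=> Cxy; exists (k * (lift x - lift y) + 2 * k * u) => //.
have [c ->] := lift01B x y; apply/ideal_span1P; exists (c - u).
by ring.
Qed.

(** The borrow contributes 4 k c, which is 0 in characteristic 4. *)
Lemma component4_diff (C : {pred 'rV[ring_R theta]_n}) (x y : cyclic_ring 'F_2 n) :
  code_ideal C (2 * k * (lift x - lift y)) -> component4 C (x - y).
Proof.
rewrite /component4; have [c ->] := lift01B x y.
suff -> : 2 * k * (lift x - lift y + 2 * c) = 2 * k * (lift x - lift y) by [].
transitivity (2 * k * (lift x - lift y) + 4 * (k * c)); first by ring.
by rewrite cyclic_ring_char4 mul0r addr0.
Qed.

Lemma code_ideal_gen (C : {pred 'rV[ring_R theta]_n}) (g : binary_family) :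
  standard_generators C g ->
  [/\ code_ideal C (gen1 theta n g), code_ideal C (gen2 theta n g),
      code_ideal C (gen3 theta n g) & code_ideal C (gen4 theta n g)].
Proof.
move=> g_std; pose s := [:: gen1 theta n g; gen2 theta n g; gen3 theta n g;
  gen4 theta n g].
by split; apply/(sg_span g_std);
   [apply: (@ideal_span_mem _ s 0) | apply: (@ideal_span_mem _ s 1)
   |apply: (@ideal_span_mem _ s 2) | apply: (@ideal_span_mem _ s 3)].
Qed.

Lemma code_ideal_sub (C : {pred 'rV[ring_R theta]_n}) (g : binary_family)
    (x y : Q) :
  standard_generators C g ->
  code_ideal C x -> code_ideal C y -> code_ideal C (x - y).
Proof.
move=> g_std /(sg_span g_std) sx /(sg_span g_std) sy.
by apply/(sg_span g_std)/ideal_span_sub.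
Qed.

End Uniqueness.

Theorem theorem3p3 (theta : 'Z_4 * 'Z_4) (n : nat)
    (C : {pred 'rV[ring_R theta]_n}) (g h : binary_family)
    (theta_in_S : theta \in theta_set) (n_gt0 : (1 <= n)%N)
    (C_cyclic : cyclic_code C)
    (g_std : standard_generators C g) (h_std : standard_generators C h) :
  [/\ gen1 theta n g = gen1 theta n h, gen2 theta n g = gen2 theta n h,
      gen3 theta n g = gen3 theta n h & gen4 theta n g = gen4 theta n h].
Proof.
have [Cg1 Cg2 Cg3 _] := code_ideal_gen g_std.
have [Ch1 Ch2 Ch3 _] := code_ideal_gen h_std.
have CB x y := @code_ideal_sub _ _ _ _ x y g_std.
have e11 := min_generator_uniq n_gt0 (sg_min1 g_std) (sg_min1 h_std).
have e22 := min_generator_uniq n_gt0 (sg_min2 g_std) (sg_min2 h_std).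
have e33 := min_generator_uniq n_gt0 (sg_min3 g_std) (sg_min3 h_std).
have e44 := min_generator_uniq n_gt0 (sg_min4 g_std) (sg_min4 h_std).
(* The degree of h i j is bounded by that of h j j; equality of the diagonal entries turns this into
   a bound by g j j. *)
have reduced_eq i j I : (1 <= i <= 3)%N -> (i < j <= 4)%N ->
    g j j = h j j -> min_generator I (g j j) ->
    I (cls n (g i j) - cls n (h i j)) -> g i j = h i j.
  move=> i_in j_in ejj min_j /(min_generator_reduced_eq n_gt0 min_j).
  by apply; [exact: sg_deg g_std i j i_in j_in
            |rewrite ejj; exact: sg_deg h_std i j i_in j_in].
(* Each row is treated from left to right, so that the earlier terms cancel in the difference of the
   two generators. *)
have e34 : g 3 4 = h 3 4.
  apply: (reduced_eq 3%N 4%N _ isT isT e44 (sg_min4 g_std)).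
  apply: component4_diff; move: (CB _ _ Cg3 Ch3).
  by rewrite /gen3 e33; congr code_ideal; ring.
have e23 : g 2 3 = h 2 3.
  apply: (reduced_eq 2%N 3%N _ isT isT e33 (sg_min3 g_std)).
  (* The witness is the difference of the fourth entries, still unknown but invisible modulo 2 k. *)
  apply: (@component3_diff _ _ _ _ _
            (lift01 theta (cls n (g 2 4)) - lift01 theta (cls n (h 2 4)))).
  by move: (CB _ _ Cg2 Ch2); rewrite /gen2 e22; congr code_ideal; ring.
have e24 : g 2 4 = h 2 4.
  apply: (reduced_eq 2%N 4%N _ isT isT e44 (sg_min4 g_std)).
  apply: component4_diff; move: (CB _ _ Cg2 Ch2).
  by rewrite /gen2 e22 e23; congr code_ideal; ring.
have e12 : g 1 2 = h 1 2.
  apply: (reduced_eq 1%N 2%N _ isT isT e22 (sg_min2 g_std)).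
  (* The third and fourth terms both contain k; factoring it out leaves this witness. *)
  apply: (@component2_diff _ _ _ _ _
            (lift01 theta (cls n (g 1 3)) - lift01 theta (cls n (h 1 3))
             + 2 * (lift01 theta (cls n (g 1 4)) - lift01 theta (cls n (h 1 4))))).
  by move: (CB _ _ Cg1 Ch1); rewrite /gen1 e11; congr code_ideal; ring.
have e13 : g 1 3 = h 1 3.
  apply: (reduced_eq 1%N 3%N _ isT isT e33 (sg_min3 g_std)).
  apply: (@component3_diff _ _ _ _ _
            (lift01 theta (cls n (g 1 4)) - lift01 theta (cls n (h 1 4)))).
  by move: (CB _ _ Cg1 Ch1); rewrite /gen1 e11 e12; congr code_ideal; ring.
have e14 : g 1 4 = h 1 4.
  apply: (reduced_eq 1%N 4%N _ isT isT e44 (sg_min4 g_std)).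
  apply: component4_diff; move: (CB _ _ Cg1 Ch1).
  by rewrite /gen1 e11 e12 e13; congr code_ideal; ring.
by split; rewrite /gen1 /gen2 /gen3 /gen4 ?e11 ?e12 ?e13 ?e14 ?e22 ?e23 ?e24
  ?e33 ?e34 ?e44.
Qed.
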